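(* Let $\tau=\frac12(1+\sqrt5)$. Then $\mathbb{Z}_{-\tau}\cap[0,+\infty)=\mathbb{Z}_{\tau^2}\cap[0,+\infty)$, where $\mathbb{Z}_{-\tau}$ is the set of $(-\tau)$-integers (negative base $-\tau$) and $\mathbb{Z}_{\tau^2}$ is the set of $(\tau^2)$-integers (positive base $\tau^2$).
   Context: Positive base (Rényi expansions). For real $\beta>1$ let $T_\beta:[0,1)\to[0,1)$, $T_\beta(y)=\beta y-\lfloor\beta y\rfloor$, and for $y\in[0,1)$ let $d_\beta(y)=y_1y_2y_3\cdots$ with $y_i=\lfloor\beta T_\beta^{i-1}(y)\rfloor$, so that $y=\sum_{i\ge1}y_i\beta^{-i}$. For $x\ge0$, the $\beta$-expansion of $x$ is the expression $x=\sum_{i=-\infty}^{k}x_i\beta^i$ ($k\in\mathbb{Z}$) such that $x_kx_{k-1}x_{k-2}\cdots=d_\beta(y)$ for some $y\in[0,1)$; it exists and is unique up to leading zeros. The set $\mathbb{Z}_\beta$ of $\beta$-integers consists of all $x\in\mathbb{R}$ such that the $\beta$-expansion of $|x|$ has $x_i=0$ for all $i<0$. Negative base (Ito–Sadahiro expansions). For real $\beta>1$ put $l_\beta=-\frac{\beta}{\beta+1}$, $r_\beta=1+l_\beta=\frac{1}{\beta+1}$, and define $T_{-\beta}:[l_\beta,r_\beta)\to[l_\beta,r_\beta)$ by $T_{-\beta}(y)=-\beta y-\lfloor-\beta y-l_\beta\rfloor$. For $y\in[l_\beta,r_\beta)$ put $d_{-\beta}(y)=y_1y_2y_3\cdots$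 where $y_i=\lfloor-\beta T_{-\beta}^{i-1}(y)-l_\beta\rfloor$ for $i\ge1$; then $y=\sum_{i\ge1}y_i(-\beta)^{-i}$. For $x\in\mathbb{R}$, the $(-\beta)$-expansion of $x$ is the expression $x=\sum_{i=-\infty}^{k}x_i(-\beta)^i$ ($k\in\mathbb{Z}$) such that $x_kx_{k-1}x_{k-2}\cdots=d_{-\beta}(y)$ for some $y$ in the open interval $(l_\beta,r_\beta)$; it exists and is unique up to leading zeros. The set $\mathbb{Z}_{-\beta}$ of $(-\beta)$-integers consists of all $x\in\mathbb{R}$ whose $(-\beta)$-expansion has $x_i=0$ for all $i<0$. *)

(* Defs.v *)
From HB Require Import structures.
From mathcomp Require Import all_boot all_order all_algebra.
From mathcomp Require Import all_classical all_reals all_analysis.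

Set Implicit Arguments.
Unset Strict Implicit.
Unset Printing Implicit Defensive.

Import Order.TTheory GRing.Theory Num.Theory.
Import numFieldNormedType.Exports.

Local Open Scope classical_set_scope.
Local Open Scope ring_scope.

Section BetaIntegers.
Context {R : realType}.
Implicit Types (b beta x y : R) (d : R -> nat -> int) (D : set R).

(* The transformations are total functions on R; they are only iterated from
   points of the intervals [0, 1) and [l_beta, r_beta), which they preserve.
   Digit sequences are indexed from 0: the digit of index i is y_(i+1). *)

Definition pos_trans beta y : R := beta * y - (Num.floor (beta * y))%:~R.

Definition pos_digits beta y (i : nat) : int :=
  Num.floor (beta * iter i (pos_trans beta) y).

Definition neg_l beta : R := - (beta / (beta + 1)).

Definition neg_r beta : R := 1 + neg_l beta.

Definition neg_trans beta y : R :=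
  - beta * y - (Num.floor (- beta * y - neg_l beta))%:~R.

Definition neg_digits beta y (i : nat) : int :=
  Num.floor (- beta * iter i (neg_trans beta) y - neg_l beta).

(* x is the sum of a i * b ^ i over the integers i <= k, and the digit string
   a k, a (k - 1), a (k - 2), ... equals d y for some y in D. The positions
   above k carry the digit 0. *)
Definition is_expansion b d D x (k : int) (a : int -> int) : Prop :=
  [/\ series (fun j : nat => (a (k - j%:Z))%:~R * b ^ (k - j%:Z)) @ \oo --> x,
      exists2 y, D y & forall j : nat, a (k - j%:Z) = d y j
    & forall i : int, k < i -> a i = 0].

Definition pos_expansion beta :=
  is_expansion beta (pos_digits beta) `[0, 1[.

Definition neg_expansion beta :=
  is_expansion (- beta) (neg_digits beta) `]neg_l beta, neg_r beta[.

Definition pos_integers beta : set R :=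
  [set x | exists k a, pos_expansion beta `|x| k a /\
                       forall i : int, i < 0 -> a i = 0].

Definition neg_integers beta : set R :=
  [set x | exists k a, neg_expansion beta x k a /\
                       forall i : int, i < 0 -> a i = 0].

End BetaIntegers.

Definition tau (R : realType) : R := 2^-1 * (1 + Num.sqrt 5).

(* Main.v *)
(** Let x' denote the Galois conjugate of x in Z[tau]. Both sets of integers,
    restricted to x >= 0, are the cut-and-project set
      { x in Z[tau] : 0 <= x' < tau^2 }.
    After n steps of the expansion of x / b^n, the remainder u is x minus the
    partial value s, which lies in Z[tau]. Conjugation turns multiplication by
    - tau (resp. tau^2) into the contraction by 1 / tau (resp. 1 / tau^2), so the
    digits keep s' in [0, tau^2). Hence |u'| < tau^2 if x' lies in [0, tau^2), and
    the only u in Z[tau] with this property in the domain of the transformation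
    are 0 and one exceptional value, which a refined bound on s' excludes. *)

Require Import Defs.
From mathcomp Require Import all_boot all_order all_algebra.
From mathcomp Require Import all_classical all_reals all_analysis.
From mathcomp Require Import ring lra zify.

Import Order.TTheory GRing.Theory Num.Theory.
Import numFieldNormedType.Exports.

Local Open Scope classical_set_scope.
Local Open Scope ring_scope.

(** * Expansions as orbits of the transformation *)

(** The recurrence telescopes: the partial sums miss the limit by [b ^ (k + 1) * (b^-1 ^+ n * u n)],
    which tends to 0 because [u] is bounded. *)
Lemma digit_series_cvg {R : realType} {b C : R} {u : nat -> R} {e : nat -> int}
    (k : int) :
  1 < `|b| -> (forall j, u j.+1 = b * u j - (e j)%:~R) ->
  (forall j, `|u j| <= C) ->
  series (fun j : nat => (e j)%:~R * b ^ (k - j%:Z)) @ \oo --> b ^ (k + 1) * u 0.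
Proof.
move=> b1 uS uC.
have b0 : b != 0 by rewrite -normr_gt0 (lt_trans _ b1).
have partial n : series (fun j : nat => (e j)%:~R * b ^ (k - j%:Z)) n =
    b ^ (k + 1) * u 0 - b ^ (k + 1) * (b^-1 ^+ n * u n).
  elim: n => [|n IHn]; first by rewrite /series /= big_geq // expr0 mul1r subrr.
  have -> : b ^ (k + 1) * (b^-1 ^+ n.+1 * u n.+1) =
      b ^ (k + 1) * (b^-1 ^+ n * u n) - b ^ (k - n%:Z) * (e n)%:~R.
    have -> : b ^ (k - n%:Z) = b ^ (k + 1) * b^-1 ^+ n.+1.
      by rewrite exprVn exprnN -expfzDr //; congr (_ ^ _); lia.
    by rewrite uS exprSr; field.
  by rewrite seriesSr IHn; ring.
rewrite (eq_cvg _ _ partial).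
suff u0 : (fun n => b^-1 ^+ n * u n) @ \oo --> 0.
  have /= := cvgB (cvg_cst (b ^ (k + 1) * u 0)) (cvgM (cvg_cst (b ^ (k + 1))) u0).
  by rewrite mulr0 subr0; apply.
apply/norm_cvg0P/(@squeeze_cvgr _ _ _ _ (fun=> 0) (geometric C `|b^-1|)).
- near=> n; rewrite normr_ge0 /= normrM normrX mulrC.
  by rewrite ler_wpM2r ?exprn_ge0.
- exact: cvg_cst.
- by apply: cvg_geometric; rewrite normr_id normfV invf_lt1 // (lt_trans _ b1).
Unshelve. all: by end_near.
Qed.

(** Digits 0 at all negative positions force the orbit to reach 0, the only point of [E] with all
    digits 0. [E] is kept apart from [D] since the open interval of the negative base is not stable
    under [T]. *)
Lemma integer_orbitP {R : realType} {b C : R} {T : R -> R} {f : R -> int}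
    {d : R -> nat -> int} {D E : set R} (x : R) :
  1 < `|b| -> (forall y, T y = b * y - (f y)%:~R) ->
  (forall y i, d y i = f (iter i T y)) -> f 0 = 0 ->
  D `<=` E -> (forall y, E y -> E (T y)) -> (forall y, E y -> `|y| <= C) ->
  (exists k a, is_expansion b d D x k a /\ forall i : int, i < 0 -> a i = 0)
  <-> exists n y, [/\ D y, x = b ^+ n * y & iter n T y = 0].
Proof.
move=> b1 TE dE f0 DE ET EC.
have E_iter y n : E y -> E (iter n T y) by move=> Ey; elim: n => //= n; apply: ET.
have sumE y k (e : nat -> int) : E y -> (forall j, e j = d y j) ->
    series (fun j : nat => (e j)%:~R * b ^ (k - j%:Z)) @ \oo --> b ^ (k + 1) * y.
  move=> Ey ey; apply: (digit_series_cvg (u := fun j => iter j T y) k b1) => j.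
    by rewrite ey dE /= TE.
  exact/EC/E_iter.
have digits0 y : E y -> (forall j, d y j = 0) -> y = 0.
  move=> Ey d0; have := sumE y (-1) _ Ey (fun=> erefl); rewrite addNr expr0z mul1r => Hy.
  apply: (cvg_unique (@norm_hausdorff _ _) Hy).
  rewrite (_ : series _ = fun=> 0); first exact: cvg_cst.
  by apply/funext => n; rewrite /series /= big1 // => j _; rewrite d0 mul0r.
split=> [[k [a [[Hx [y Dy ay] _] a0]]]|[n [y [Dy -> yn]]]].
  have Ey := DE _ Dy.
  have {Hx} -> : x = b ^ (k + 1) * y.
    apply: (cvg_unique (@norm_hausdorff _ _) Hx).
    exact: sumE.
  have [k1|k1] := leP 0 (k + 1).
    exists `|(k + 1)%R|%N, y; split=> //; first by rewrite -[in LHS](gez0_abs k1).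
    apply: digits0 => [|j]; first exact: E_iter.
    by rewrite dE -iterD -dE -ay a0 //; lia.
  (* Here every position [k - j] is negative, so all digits of [y] vanish. *)
  have y0 : y = 0 by apply: digits0 => // j; rewrite -ay a0 //; lia.
  by exists 0%N, y; split=> //; rewrite y0 !mulr0.
have Ey := DE _ Dy.
have T0 : T 0 = 0 by rewrite TE f0 mulr0 subrr.
(* The first digit of [y] has weight [b ^ (-1)], hence position [n - 1] in [b ^+ n * y]. *)
exists (n%:Z - 1), (fun i => if n%:Z - 1 < i then 0 else d y `|(n%:Z - 1 - i)%R|%N).
have aE (j : nat) : (if n%:Z - 1 < n%:Z - 1 - j%:Z then 0
    else d y `|(n%:Z - 1 - (n%:Z - 1 - j%:Z))%R|%N) = d y j.
  rewrite ifF; last by lia.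
  by congr (d y _); lia.
split; first split.
- by have := sumE y (n%:Z - 1) _ Ey aE; rewrite subrK.
- by exists y.
- by move=> i ->.
- move=> i i0; case: ifP => // ni.
  (* A negative position is read after at least [n] steps, when the orbit already rests at 0. *)
  have -> : `|(n%:Z - 1 - i)%R|%N = (`|(- 1 - i)%R| + n)%N by lia.
  rewrite dE iterD yn (_ : iter _ T 0 = 0) //.
  by elim: `|_|%N => //= m ->.
Qed.

(** * Arithmetic and conjugation in Z[tau] *)

Lemma tau_sqr (R : realType) : tau R ^+ 2 = tau R + 1.
Proof.
rewrite /tau exprMn sqrrD sqr_sqrtr // expr1n mul1r.
by set s := Num.sqrt _; field.
Qed.

Lemma tau_bounds (R : realType) : 8 / 5 < tau R < 13 / 8.
Proof.
have t0 : 0 <= tau R by rewrite mulr_ge0 ?addr_ge0 ?sqrtr_ge0.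
have t2 := tau_sqr R; nra.
Qed.

Lemma neg_l_tau (R : realType) : neg_l (tau R) = 1 - tau R.
Proof.
have t2 := tau_sqr R; have tb := tau_bounds R.
have t0 : tau R != 0 by lra.
rewrite /neg_l -t2 expr2 invfM mulrA divff // mul1r.
by apply: (mulfI t0); rewrite mulrN divff //; lra.
Qed.

(* [c] is the conjugate of [x] in Z[tau]; it is determined by [x], as tau is
   irrational, but no uniqueness is required. *)
Definition golden_conj {R : realType} (x c : R) : Prop :=
  exists p q : int, x = p%:~R + q%:~R * tau R /\ c = p%:~R + q%:~R * (1 - tau R).

Lemma golden_conj0 {R : realType} : golden_conj (0 : R) 0.
Proof. by exists 0, 0; rewrite !mul0r addr0. Qed.

Lemma golden_conjB {R : realType} {x c y d : R} :
  golden_conj x c -> golden_conj y d -> golden_conj (x - y) (c - d).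
Proof.
move=> [p [q [-> ->]]] [r [s [-> ->]]]; exists (p - r), (q - s).
by rewrite !intrB; split; ring.
Qed.

(** The factors [tau R - 1] here and [2 - tau R] in the next lemma are 1 / tau and 1 / tau^2, the
    conjugates of the two bases. *)
Lemma golden_conj_mulN {R : realType} {x c : R} (e : int) :
  golden_conj x c ->
  golden_conj (- tau R * x + e%:~R) (c * (tau R - 1) + e%:~R).
Proof.
move=> [p [q [-> ->]]]; exists (e - q), (- p - q).
rewrite !intrB mulrNz; have t2 := tau_sqr R; split; ring: t2.
Qed.

Lemma golden_conj_mul_sqr {R : realType} {x c : R} (e : int) :
  golden_conj x c ->
  golden_conj (tau R ^+ 2 * x + e%:~R) (c * (2 - tau R) + e%:~R).
Proof.
move=> [p [q [-> ->]]]; exists (p + q + e), (p + q + q).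
rewrite !intrD; have t2 := tau_sqr R; split; ring: t2.
Qed.

Lemma intr_between {R : realType} (z m : int) :
  (m - 1)%:~R < z%:~R :> R -> z%:~R < (m + 1)%:~R :> R -> z = m.
Proof. by rewrite !ltr_int; lia. Qed.

(** Since [x - c] is [q] times [2 * tau R - 1], the bounds give [|q| < 2], and each [q] leaves one
    [p]. The interval for [x] covers the domains of both transformations. *)
Lemma golden_discrete {R : realType} (x c : R) :
  golden_conj x c -> - (tau R + 1) < c < tau R + 1 -> 1 - tau R <= x < 1 ->
  [\/ x = 0, x = 1 - tau R /\ c = tau R | x = tau R - 1 /\ c = - tau R].
Proof.
move=> [p [q [-> ->]]] /andP[c1 c2] /andP[x1 x2].
have /andP[t1 t2] := tau_bounds R.
have q1 : (- 2)%:~R < q%:~R :> R by nra.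
have q2 : q%:~R < 2%:~R :> R by nra.
move: q1 q2; rewrite !ltr_int => q1 q2.
have : [|| q == 0, q == 1 | q == -1] by lia.
case/or3P => /eqP qE; subst q.
- have -> : p = 0 by apply: (@intr_between R); lra.
  by constructor 1; rewrite !mul0r addr0.
- have -> : p = - 1 by apply: (@intr_between R); lra.
  by constructor 3; split; lra.
- have -> : p = 1 by apply: (@intr_between R); lra.
  by constructor 2; split; lra.
Qed.

(** * Conjugate bounds along the two orbits *)

Lemma neg_trans_step {R : realType} {y : R} :
  1 - tau R <= y < 2 - tau R ->
  exists2 e : int, e = 0 \/ e = 1 &
    neg_trans (tau R) y = - tau R * y - e%:~R /\
    1 - tau R <= neg_trans (tau R) y < 2 - tau R.
Proof.
move=> /andP[y1 y2]; have t2 := tau_sqr R; have /andP[tb1 tb2] := tau_bounds R.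
rewrite /neg_trans neg_l_tau.
have /andP[] := floor_itv (- tau R * y - (1 - tau R)).
set e := Num.floor _; rewrite intrD => e1 e2.
exists e; last by split=> //; lra.
have eN : (-1)%:~R < e%:~R :> R by nra.
have eP : e%:~R < 2%:~R :> R by nra.
by move: eN eP; rewrite !ltr_int; lia.
Qed.

(* The endpoint [1 - tau] is only reached after a digit 1, whence the refined
   bound on [c]. *)
Lemma neg_orbit {R : realType} (y : R) (n : nat) :
  1 - tau R < y < 2 - tau R ->
  let u := iter n (neg_trans (tau R)) y in
  1 - tau R <= u < 2 - tau R /\
  exists2 c, golden_conj ((- tau R) ^+ n * y - u) c &
    0 <= c < tau R + 1 /\ (u = 1 - tau R -> 1 <= c).
Proof.
have /andP[tb1 tb2] := tau_bounds R; have t2 := tau_sqr R.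
move=> /andP[y1 y2]; elim: n => [|n [un [c gc [/andP[c0 c1] cu]]]] /=.
  rewrite mul1r subrr ltW // y2; split=> //; exists 0; first exact: golden_conj0.
  by split=> [|yE]; lra.
move: un gc cu; set u := iter n _ y => un gc cu.
have [e e01 [uE uS]] := neg_trans_step un; split=> //.
exists (c * (tau R - 1) + e%:~R).
  rewrite exprS uE
    (_ : _ - _ = - tau R * ((- tau R) ^+ n * y - u) + e%:~R); last by ring.
  exact: golden_conj_mulN.
move: un uS => /andP[u1 u2]; rewrite uE.
(* The bound [tau R + 1] is the fixed point of [c * (tau R - 1) + 1]. Reaching [1 - tau R] with
   digit 0 would need [u = 2 - tau R], outside the domain. *)
by case: e01 => -> /andP[u3 u4]; split=> [|?]; [apply/andP; split|..]; nra.
Qed.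

Lemma pos_trans_step {R : realType} {y : R} :
  0 <= y < 1 ->
  exists2 e : int, [\/ e = 0, e = 1 | e = 2] &
    pos_trans (tau R ^+ 2) y = tau R ^+ 2 * y - e%:~R /\
    0 <= pos_trans (tau R ^+ 2) y < 1.
Proof.
move=> /andP[y1 y2]; have t2 := tau_sqr R; have /andP[tb1 tb2] := tau_bounds R.
rewrite /pos_trans.
have /andP[] := floor_itv (tau R ^+ 2 * y).
set e := Num.floor _; rewrite intrD => e1 e2.
exists e; last by split=> //; lra.
have eN : (-1)%:~R < e%:~R :> R by nra.
have eP : e%:~R < 3%:~R :> R by nra.
move: eN eP; rewrite !ltr_int => eN eP.
have : [|| e == 0, e == 1 | e == 2] by lia.
by case/or3P => /eqP ->; [constructor 1|constructor 2|constructor 3].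
Qed.

(* A digit 2 needs [u >= 2 / tau^2 > 1 / tau = tau - 1]; the refined bound then
   keeps [c] below tau^2 in spite of it. *)
Lemma pos_orbit {R : realType} (y : R) (n : nat) :
  0 <= y < 1 ->
  let u := iter n (pos_trans (tau R ^+ 2)) y in
  0 <= u < 1 /\
  exists2 c, golden_conj ((tau R ^+ 2) ^+ n * y - u) c &
    0 <= c < tau R + 1 /\ (tau R - 1 <= u -> c < tau R).
Proof.
have /andP[tb1 tb2] := tau_bounds R; have t2 := tau_sqr R.
move=> yI; elim: n => [|n [un [c gc [/andP[c0 c1] cu]]]] /=.
  rewrite mul1r subrr; split=> //; exists 0; first exact: golden_conj0.
  by split=> [|yE]; lra.
move: un gc cu; set u := iter n _ y => un gc cu.
have [e e012 [uE uS]] := pos_trans_step un; split=> //.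
exists (c * (2 - tau R) + e%:~R).
  rewrite exprS uE
    (_ : _ - _ = tau R ^+ 2 * ((tau R ^+ 2) ^+ n * y - u) + e%:~R); last by ring.
  exact: golden_conj_mul_sqr.
move: un uS => /andP[u1 u2]; rewrite uE t2.
(* The largest possible digit, 2 in the first case and 1 in the second, leaves a remainder below
   [tau R - 1], so the refined bound only concerns smaller digits. *)
have [ut|ut] := leP (tau R - 1) u.
  move: {cu} (cu ut) => cu.
  by case: e012 => -> /andP[u3 u4]; split=> [|?]; [apply/andP; split|..]; nra.
by case: e012 => -> /andP[u3 u4]; split=> [|?]; [apply/andP; split|..]; nra.
Qed.

(** * Both sets of integers as a cut-and-project set *)

Lemma scale_lt {R : realType} {b eps : R} (x : R) :
  1 < `|b| -> 0 < eps -> exists n, `|x / b ^+ n| < eps.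
Proof.
move=> b1 e0.
have bV : `|b^-1| < 1 by rewrite normfV invf_lt1 // (lt_trans _ b1).
have /cvgrPdist_lt /(_ _ e0) [n _ nP] := cvg_geometric x bV.
exists n; have := nP n (leqnn n).
by rewrite /= sub0r normrN exprVn.
Qed.

Lemma neg_integers_golden {R : realType} (x : R) :
  neg_integers (tau R) x <-> exists2 c, golden_conj x c & 0 <= c < tau R + 1.
Proof.
have t2 := tau_sqr R; have /andP[tb1 tb2] := tau_bounds R.
have b1 : 1 < `|- tau R| by rewrite normrN gtr0_norm; lra.
have rE : neg_r (tau R) = 2 - tau R by rewrite /neg_r neg_l_tau; lra.
have DE y : `]neg_l (tau R), neg_r (tau R)[%classic y =
    (1 - tau R < y < 2 - tau R) :> Prop.
  by rewrite neg_l_tau rE /= in_itv.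
have f0 : Num.floor (- tau R * 0 - neg_l (tau R)) = 0.
  by apply/eqP; rewrite neg_l_tau mulr0 floor_eq; lra.
have DI : `]neg_l (tau R), neg_r (tau R)[ `<=`
    [set y | 1 - tau R <= y < 2 - tau R].
  by move=> y; rewrite DE /= => /andP[/ltW -> ->].
have stable y : 1 - tau R <= y < 2 - tau R ->
    1 - tau R <= neg_trans (tau R) y < 2 - tau R.
  by move=> yI; have [e _ [_ eI]] := neg_trans_step yI.
have bounded y : 1 - tau R <= y < 2 - tau R -> `|y| <= 1.
  by move=> /andP[y1 y2]; rewrite ler_norml; lra.
apply: (iff_trans (integer_orbitP
  (f := fun y => Num.floor (- tau R * y - neg_l (tau R)))
  x b1 (fun=> erefl) (fun _ _ => erefl) f0 DI stable bounded)).
split=> [[n [y [yI -> yn]]]|[c gc /andP[c0 c1]]].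
  rewrite DE in yI.
  have [_ [c gc [c01 _]]] := neg_orbit y n yI.
  by exists c; rewrite // -[X in golden_conj X](subr0) -yn.
(* [2 - tau R] is the distance from 0 to the nearer endpoint of the domain. *)
have [|n xn] := scale_lt (eps := 2 - tau R) x b1; first lra.
have bn : (- tau R) ^+ n != 0 by rewrite expf_neq0 // oppr_eq0; lra.
have yI : 1 - tau R < x / (- tau R) ^+ n < 2 - tau R.
  by move: xn; rewrite ltr_norml; lra.
exists n, (x / (- tau R) ^+ n); rewrite DE; split=> //.
  by rewrite mulrC divfK.
have [] := neg_orbit _ n yI; set u := iter n _ _ => uI [d gd [/andP[d0 d1] du]].
have := golden_conjB gc gd; rewrite mulrC divfK // subKr => gu.
(* If [u = 1 - tau R], then [c - d = tau R] and [1 <= d] contradict [c < tau R + 1]; [tau R - 1] is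
   outside the domain. *)
by case: (golden_discrete _ _ gu); lra.
Qed.

Lemma pos_integers_golden {R : realType} (x : R) : 0 <= x ->
  pos_integers (tau R ^+ 2) x <-> exists2 c, golden_conj x c & 0 <= c < tau R + 1.
Proof.
move=> x0; have t2 := tau_sqr R; have /andP[tb1 tb2] := tau_bounds R.
have b1 : 1 < `|tau R ^+ 2| by rewrite gtr0_norm; lra.
have DE y : `[0, 1[%classic y = (0 <= y < 1) :> Prop by rewrite /= in_itv.
have f0 : Num.floor (tau R ^+ 2 * 0) = 0 by rewrite mulr0 floor0.
have DI : `[0, 1[ `<=` [set y : R | 0 <= y < 1] by move=> y; rewrite DE.
have stable y : 0 <= y < 1 -> 0 <= pos_trans (tau R ^+ 2) y < 1.
  by move=> yI; have [e _ [_ eI]] := pos_trans_step yI.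
have bounded (y : R) : 0 <= y < 1 -> `|y| <= 1.
  by move=> /andP[y1 y2]; rewrite ler_norml; lra.
rewrite /pos_integers /= ger0_norm //.
apply: (iff_trans (integer_orbitP (f := fun y => Num.floor (tau R ^+ 2 * y))
  x b1 (fun=> erefl) (fun _ _ => erefl) f0 DI stable bounded)).
split=> [[n [y [yI -> yn]]]|[c gc /andP[c0 c1]]].
  rewrite DE in yI.
  have [_ [c gc [c01 _]]] := pos_orbit y n yI.
  by exists c; rewrite // -[X in golden_conj X](subr0) -yn.
have [|n xn] := scale_lt (eps := 1) x b1; first lra.
have bn : 0 < (tau R ^+ 2) ^+ n by rewrite exprn_gt0; lra.
have yI : 0 <= x / (tau R ^+ 2) ^+ n < 1.
  by rewrite divr_ge0 ?(ltW bn) //=; move: xn; rewrite ltr_norml; lra.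
exists n, (x / (tau R ^+ 2) ^+ n); rewrite DE; split=> //.
  by rewrite mulrC divfK // gt_eqF.
have [] := pos_orbit _ n yI; set u := iter n _ _ => uI [d gd [/andP[d0 d1] du]].
have := golden_conjB gc gd; rewrite mulrC divfK ?gt_eqF // subKr => gu.
(* Now [1 - tau R] is negative, and [u = tau R - 1] gives [c = d - tau R < 0]. *)
by case: (golden_discrete _ _ gu); lra.
Qed.

Theorem theorem7p3 (R : realType) :
  neg_integers (tau R) `&` `[0, +oo[ = pos_integers (tau R ^+ 2) `&` `[0, +oo[.
Proof.
apply/seteqP; split=> x [xZ x0]; split=> //; move: (x0) xZ;
  rewrite /= in_itv /= andbT => x_ge0.
  by rewrite neg_integers_golden -pos_integers_golden.
by rewrite pos_integers_golden // -neg_integers_golden.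
Qed.
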